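(* Let $\pi_\theta$ be a tabular policy, $\mathcal{S}\subseteq\mathcal{X}$ a set of training prompts, $r_{\mathrm{G}}:\mathcal{X}\times\mathcal{Y}\to[-1,1]$ the ground truth reward, and $\mathbf{x}\in\mathcal{S}$. Let $V_0\in(-1,1)$ and let $\gamma>0$ be such that there exist outputs $\mathbf{y}^\gamma,\mathbf{y}^{\prime\gamma}\in\mathcal{Y}$ satisfying $r_{\mathrm{G}}(\mathbf{x},\mathbf{y}^\gamma)>V_0+\gamma$ and $r_{\mathrm{G}}(\mathbf{x},\mathbf{y}^{\prime\gamma})>V_0+\gamma$. When gradient flow is used to maximize the RLHF objective over $\mathcal{S}$, denote by $t_\gamma$ the initial (first) time $t \ge 0$ at which $\mathbb{E}_{\mathbf{y}\sim\pi_{\theta(t)}(\cdot|\mathbf{x})}[r_{\mathrm{G}}(\mathbf{x},\mathbf{y})]\ge\mathbb{E}_{\mathbf{y}\sim\pi_{\theta(0)}(\cdot|\mathbf{x})}[r_{\mathrm{G}}(\mathbf{x},\mathbf{y})]+\gamma$ (with $t_\gamma=\infty$ if no such time exists). Then, for any $T\ge1$, constant $c\in(0,1)$, and the initial policy families $$\Pi:=\Big\{\pi_\theta:\ \mathbb{E}_{\mathbf{y}\sim\pi_\theta(\cdot|\mathbf{x})}[r_{\mathrm{G}}(\mathbf{x},\mathbf{y})]=V_0,\ \pi_\theta(\mathbf{y}^{\prime\gamma}|\mathbf{x})\le T^{-2},\ \pi_\theta(\mathbf{y}^\gamma|\mathbf{x})\ge c\Big\},$$ $$\Pi':=\Big\{\pi_\theta:\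 \mathbb{E}_{\mathbf{y}\sim\pi_\theta(\cdot|\mathbf{x})}[r_{\mathrm{G}}(\mathbf{x},\mathbf{y})]=V_0,\ \pi_\theta(\mathbf{y}^{\gamma}|\mathbf{x})\le T^{-2},\ \pi_\theta(\mathbf{y}^{\prime\gamma}|\mathbf{x})\ge c\Big\},$$ there exist reward models $r_{\mathrm{RM}},r'_{\mathrm{RM}}:\mathcal{X}\times\mathcal{Y}\to[-1,1]$ such that the following hold. (1) If $\pi_{\theta(0)}\in\Pi$, then when using $r_{\mathrm{RM}}$ for maximizing the RLHF objective with KL coefficient $0\le\lambda\le\frac{c(1-\rho)^3}{16\left(\frac{1}{2e}-2\ln\min_{\mathbf{y}\in\mathcal{Y}}\pi_{\theta(0)}(\mathbf{y}|\mathbf{x})\right)}$, $$t_\gamma\le\frac{2|\mathcal{S}|}{(1-\rho)^3}\cdot\left(\frac1c-\frac1\rho\right)=O(1),$$ where $\rho:=\frac{\mathbb{E}_{\mathbf{y}\sim\pi_{\theta(0)}(\cdot|\mathbf{x})}[r_{\mathrm{G}}(\mathbf{x},\mathbf{y})]+\gamma+1}{r_{\mathrm{G}}(\mathbf{x},\mathbf{y}^\gamma)+1}\in(0,1)$, while when using $r'_{\mathrm{RM}}$ (with KL coefficient $\lambda \ge 0$), $$t_\gamma\ge\frac{|\mathcal{S}|}{\sqrt2}\left(1-\exp\left(-\frac\gamma2\right)\right)\cdot T=\Omega(T).$$ (2) If $\pi_{\theta(0)}\in\Pi'$, then when using $r'_{\mathrm{RM}}$ for maximizing the RLHF objective with KL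 coefficient $0\le\lambda\le\frac{c(1-\rho')^3}{16\left(\frac{1}{2e}-2\ln\min_{\mathbf{y}\in\mathcal{Y}}\pi_{\theta(0)}(\mathbf{y}|\mathbf{x})\right)}$, $$t_\gamma\le\frac{2|\mathcal{S}|}{(1-\rho')^3}\cdot\left(\frac1c-\frac1{\rho'}\right)=O(1),$$ where $\rho':=\frac{\mathbb{E}_{\mathbf{y}\sim\pi_{\theta(0)}(\cdot|\mathbf{x})}[r_{\mathrm{G}}(\mathbf{x},\mathbf{y})]+\gamma+1}{r_{\mathrm{G}}(\mathbf{x},\mathbf{y}^{\prime\gamma})+1}\in(0,1)$, while when using $r_{\mathrm{RM}}$ (with KL coefficient $\lambda \ge 0$), $$t_\gamma\ge\frac{|\mathcal{S}|}{\sqrt2}\left(1-\exp\left(-\frac\gamma2\right)\right)\cdot T=\Omega(T).$$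
   Context: Setting. $\mathcal{X}$ (prompts) and $\mathcal{Y}$ (outputs) are finite sets and $\mathcal{S}\subseteq\mathcal{X}$ is nonempty. Tabular policy: for $\theta\in\mathbb{R}^{|\mathcal{Y}|\times|\mathcal{X}|}$, $\pi_\theta(\mathbf{y}|\mathbf{x})=\mathrm{softmax}(\theta_{:,\mathbf{x}})_{\mathbf{y}}=\exp(\theta_{\mathbf{y},\mathbf{x}})/\sum_{\mathbf{y}'\in\mathcal{Y}}\exp(\theta_{\mathbf{y}',\mathbf{x}})$, where $\theta_{:,\mathbf{x}}$ is the column of $\theta$ corresponding to $\mathbf{x}$. RLHF objective with respect to a reward model $r_{\mathrm{RM}}:\mathcal{X}\times\mathcal{Y}\to[-1,1]$ and KL coefficient $\lambda\ge0$: $$\phi_{\mathrm{RLHF}}(\theta):=\mathbb{E}_{\mathbf{x}\sim\mathcal{S}}\Big[\mathbb{E}_{\mathbf{y}\sim\pi_\theta(\cdot|\mathbf{x})}[r_{\mathrm{RM}}(\mathbf{x},\mathbf{y})]-\lambda\cdot\mathrm{KL}\big(\pi_\theta(\cdot|\mathbf{x})\,\|\,\pi_{\theta_{\mathrm{ref}}}(\cdot|\mathbf{x})\big)\Big],$$ with $\mathbf{x}\sim\mathcal{S}$ uniform. Gradient flow: $\frac{d}{dt}\theta(t)=\nabla\phi_{\mathrm{RLHF}}(\theta(t))$, $t\ge0$, with $\theta(0)=\theta_{\mathrm{ref}}$. The $\Omega(\cdot)$ and $O(\cdot)$ expressions merely summarize the explicit bounds. *)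

(* Defs.v *)
From HB Require Import structures.
From mathcomp Require Import all_boot all_order all_algebra.
From mathcomp Require Import all_classical all_reals all_analysis.

Set Implicit Arguments.
Unset Strict Implicit.
Unset Printing Implicit Defensive.

Import Order.TTheory GRing.Theory Num.Theory.
Import numFieldNormedType.Exports.

Local Open Scope classical_set_scope.
Local Open Scope ring_scope.

Section RLHF.
Context {R : realType} {X Y : finType}.

(* The parameters form a |Y| x |X| real matrix; [enum_rank] numbers the outputs
   (rows) and the prompts (columns). *)
Definition policy (theta : 'M[R]_(#|Y|, #|X|)) (x : X) (y : Y) : R :=
  expR (theta (enum_rank y) (enum_rank x)) /
  \sum_(y' : Y) expR (theta (enum_rank y') (enum_rank x)).

Definition expectation (p f : Y -> R) : R := \sum_(y : Y) p y * f y.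

Definition KL (p q : Y -> R) : R := \sum_(y : Y) p y * ln (p y / q y).

Definition is_reward (r : X -> Y -> R) : Prop := forall x y, -1 <= r x y <= 1.

Definition rlhf_objective (S : {set X}) (r : X -> Y -> R) (lambda : R)
    (theta_ref theta : 'M[R]_(#|Y|, #|X|)) : R :=
  #|S|%:R^-1 * \sum_(x in S)
    (expectation (policy theta x) (r x)
     - lambda * KL (policy theta x) (policy theta_ref x)).

Definition gradient m n (f : 'M[R]_(m, n) -> R) (a : 'M[R]_(m, n)) :
    'M[R]_(m, n) :=
  \matrix_(i, j) 'D_(delta_mx i j) f a.

(* Only the values [theta t] with [0 <= t] matter; accordingly the derivative
   at time [0] is the right derivative. *)
Definition gradient_flow m n (phi : 'M[R]_(m, n) -> R)
    (theta0 : 'M[R]_(m, n)) (theta : R -> 'M[R]_(m, n)) : Prop :=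
  [/\ theta 0 = theta0,
      h^-1 *: (theta h - theta 0) @[h --> 0^'+] --> gradient phi (theta 0) &
      forall t : R, 0 < t -> is_derive t (1 : R) theta (gradient phi (theta t))].

Definition rlhf_flow (S : {set X}) (r : X -> Y -> R) (lambda : R)
    (theta0 : 'M[R]_(#|Y|, #|X|)) (theta : R -> 'M[R]_(#|Y|, #|X|)) : Prop :=
  gradient_flow (rlhf_objective S r lambda theta0) theta0 theta.

(* First time at which the expectation of [rG] at [x] has increased by
   [gamma]: the trajectory being continuous, the infimum is attained when the
   set is nonempty, and it is [+oo] when the set is empty. *)
Definition t_increase (rG : X -> Y -> R) (x : X) (gamma : R)
    (theta : R -> 'M[R]_(#|Y|, #|X|)) : \bar R :=
  ereal_inf [set t%:E | t in
    [set t : R | 0 <= t /\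
       expectation (policy (theta 0) x) (rG x) + gamma
         <= expectation (policy (theta t) x) (rG x)]].

Definition policy_family (rG : X -> Y -> R) (x : X) (V0 T c : R)
    (ylow yhigh : Y) : set (X -> Y -> R) :=
  [set policy theta | theta in [set theta : 'M[R]_(#|Y|, #|X|) |
     [/\ expectation (policy theta x) (rG x) = V0,
         policy theta x ylow <= T ^- 2 &
         c <= policy theta x yhigh]]].

Definition rho (rG : X -> Y -> R) (x : X) (gamma : R)
    (theta0 : 'M[R]_(#|Y|, #|X|)) (y : Y) : R :=
  (expectation (policy theta0 x) (rG x) + gamma + 1) / (rG x y + 1).

(* Probabilities are at most [1], so the neutral element [1] does not affect
   the minimum over the outputs. *)
Definition min_prob (theta : 'M[R]_(#|Y|, #|X|)) (x : X) : R :=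
  \big[Num.min/1]_(y : Y) policy theta x y.

Definition lambda_max (c rho : R) (theta0 : 'M[R]_(#|Y|, #|X|)) (x : X) : R :=
  c * (1 - rho) ^+ 3 /
  (16 * ((2 * expR 1)^-1 - 2 * ln (min_prob theta0 x))).

End RLHF.

(* Main.v *)
(** Take for r_RM the reward that is 5/8 at y^gamma and 0 elsewhere, and likewise
    for r'_RM at y'^gamma. At the prompt x the flow only moves the column of x,
    along sigma w with sigma = 1/|S| and w the gradient of the regularized reward
    F = (5/8) p - lambda KL, where p is the probability of the rewarded output.

    Upper bound: the admissible lambda only perturbs p' >= (5/8) sigma p^2 (1-p)^2,
    so 1/p decreases at rate at least sigma (1-rho)^3 / 2 as long as p < rho, while
    p >= rho forces the expected ground truth reward above its initial value + gamma.

    Lower bound, uniform in lambda: F increases from a point where KL = 0, hence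
    lambda KL <= (5/8) p. This controls the Hessian of F along the flow and gives,
    for N = |w|^2, N' <= (15/4) sigma p N, besides |(ln p)'| <= sigma sqrt(2 N).
    Since p(0) <= T^-2, comparison with the solution 1/(T^2 - omega sigma t) of
    u' = omega sigma u^2 bounds both p and sqrt N, and the expected ground truth
    reward has speed at most sigma sqrt(2 N). *)

Require Import Defs.
From mathcomp Require Import all_boot all_order all_algebra.
From mathcomp Require Import all_classical all_reals all_analysis.
From mathcomp Require Import ring lra.
Import Defs.

Import Order.TTheory GRing.Theory Num.Theory.
Import numFieldNormedType.Exports.

Local Open Scope classical_set_scope.
Local Open Scope ring_scope.

(** * Calculus of real functions of one variable: derivatives, monotonicity, a barrier principle *)

Section RealFunctions.
Set Implicit Arguments.
Unset Strict Implicit.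
Context {R : realType}.
Implicit Types (f g : R -> R) (t a b : R).

Lemma is_derive1_eq f g t a b :
  is_derive t 1 f a -> f =1 g -> a = b -> is_derive t 1 g b.
Proof. by move=> df /funext <- <-. Qed.

Lemma is_derive1M f g t a b : is_derive t 1 f a -> is_derive t 1 g b ->
  is_derive t 1 (fun u => f u * g u) (a * g t + f t * b).
Proof.
move=> df dg; apply: is_derive1_eq (is_deriveM df dg) _ _ => //.
by rewrite addrC [_ *: a]mulrC.
Qed.

Lemma is_derive1Ml (k : R) f t a : is_derive t 1 f a ->
  is_derive t 1 (fun u => k * f u) (k * a).
Proof. by move=> df; exact: is_derive1_eq (is_deriveZ k df) _ _. Qed.

Lemma is_derive1Mr (k : R) f t a : is_derive t 1 f a ->
  is_derive t 1 (fun u => f u * k) (a * k).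
Proof.
by move=> df; apply: is_derive1_eq (is_derive1Ml k df) _ _ => [u|]; rewrite mulrC.
Qed.

Lemma is_derive1D f g t a b : is_derive t 1 f a -> is_derive t 1 g b ->
  is_derive t 1 (fun u => f u + g u) (a + b).
Proof. by move=> df dg; exact: is_derive1_eq (is_deriveD df dg) _ _. Qed.

Lemma is_derive1B f g t a b : is_derive t 1 f a -> is_derive t 1 g b ->
  is_derive t 1 (fun u => f u - g u) (a - b).
Proof. by move=> df dg; exact: is_derive1_eq (is_deriveB df dg) _ _. Qed.

Lemma is_derive1_ln_comp f t a : 0 < f t -> is_derive t 1 f a ->
  is_derive t 1 (fun u => ln (f u)) (a / f t).
Proof.
move=> f0 df; apply: is_derive1_eq (is_derive1_comp (is_derive1_ln f0) df) _ _ => //.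
by rewrite mulrC.
Qed.

Lemma is_derive1_expR_comp f t a : is_derive t 1 f a ->
  is_derive t 1 (fun u => expR (f u)) (expR (f t) * a).
Proof.
by move=> df; exact: is_derive1_eq (is_derive1_comp (is_derive_expR _) df) _ _.
Qed.

Lemma is_derive1V f t a : f t != 0 -> is_derive t 1 f a ->
  is_derive t 1 (fun u => (f u)^-1) (- a / f t ^+ 2).
Proof.
move=> f0 df; apply: is_derive1_eq (is_deriveV f0 df) _ _ => //.
by rewrite mulNr mulrC scaleNr.
Qed.

Lemma is_derive1_sum (I : finType) (P : pred I) (h : I -> R -> R) t
    (dh : I -> R) : (forall i, P i -> is_derive t 1 (h i) (dh i)) ->
  is_derive t 1 (fun u => \sum_(i | P i) h i u) (\sum_(i | P i) dh i).
Proof.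
move=> dhi.
have -> : (fun u => \sum_(i | P i) h i u) = \sum_(i | P i) h i.
  by apply/funext => u; rewrite fct_sumE.
elim/big_ind2 : _ => // [|*]; [exact: is_derive_cst|exact: is_deriveD].
Qed.

Lemma is_derive1_continuous f t a : is_derive t 1 f a -> {for t, continuous f}.
Proof.
by move=> [df _]; apply/differentiable_continuous; rewrite -derivable1_diffP.
Qed.

(** Mean value theorem. The sign of the derivative is asked only before [b], so that a barrier
    argument can conclude at [b] from bounds known at earlier times. *)
Lemma is_derive1_nincr f (df : R -> R) (b : R) : 0 <= b ->
  (forall t, 0 <= t <= b -> is_derive t 1 f (df t)) ->
  (forall t, 0 <= t < b -> df t <= 0) -> f b <= f 0.
Proof.
rewrite le_eqVlt => /predU1P[<- //|b0] fd df0.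
have [||c cb E] := @MVT R f df 0 b b0.
- by move=> t; rewrite in_itv/= => /andP[/ltW t0 /ltW tb]; apply: fd; rewrite t0.
- apply: derivable_within_continuous => t; rewrite in_itv/= => tb.
  by have [] := fd _ tb.
rewrite -subr_le0 E subr0 mulr_le0_ge0 ?(ltW b0)// df0//.
by move: cb; rewrite in_itv/= => /andP[/ltW -> ->].
Qed.

(** First-failure argument: at the infimum of the failure times the step hypothesis gives a negative
    value, and continuity keeps [f] negative just after it, a contradiction. At time [0] the premise
    of the step is vacuous, so the step also carries the initial condition. *)
Lemma continuous_barrier f (b : R) :
  (forall t, 0 <= t <= b -> {for t, continuous f}) ->
  (forall t, 0 <= t <= b -> (forall u, 0 <= u < t -> f u < 0) -> f t < 0) ->
  forall t, 0 <= t <= b -> f t < 0.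
Proof.
move=> fc step t tb; rewrite ltNge; apply/negP => ft.
pose A := [set u | 0 <= u <= b /\ 0 <= f u].
have infA : has_inf A by split; [exists t|exists 0 => u [/andP[]]].
have m0 : 0 <= inf A.
  by apply: lb_le_inf; [case: infA|move=> u [/andP[]]].
have mb : inf A <= b.
  case/andP: (tb) => _ tb'; apply: le_trans tb'.
  by apply: ge_inf; [case: infA|].
have bel u : 0 <= u < inf A -> f u < 0.
  move=> /andP[u0 um]; rewrite ltNge; apply/negP => fu.
  have : inf A <= u.
    by apply: ge_inf; [case: infA|split=> //; rewrite u0 (le_trans (ltW um))].
  by rewrite leNgt um.
have m0b : 0 <= inf A <= b by rewrite m0 mb.
have fm := step _ m0b bel.
have /cvgrPdist_lt := fc _ m0b.
rewrite -oppr_gt0 in fm.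
move=> /(_ _ fm) /nbhs_ballP[e /= e0 he].
have [u [ub fu] ue] := inf_adherent e0 infA.
have mu : inf A <= u by apply: ge_inf; [case: infA|split].
have /he : ball (inf A) e u.
  by rewrite /ball/= distrC ger0_norm ?subr_ge0// ltrBlDl.
rewrite distrC => /(le_lt_trans (ler_norm _)).
by rewrite ltrBlDr addNr ltNge fu.
Qed.

End RealFunctions.

(** * Differentiation of softmax probabilities and of the regularized reward along a curve of
    logits *)

Section Softmax.
Set Implicit Arguments.
Unset Strict Implicit.
Context {R : realType} {Y : finType}.
Implicit Types (th v p q r f : Y -> R) (y z : Y).

Definition softmax th z : R := expR (th z) / \sum_k expR (th k).

Definition regularized_reward p q r (lambda : R) : R :=
  expectation p r - lambda * KL p q.

(** Partial derivative of the regularized reward in the logit of [z]: probability times centered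
    advantage. The constant produced by differentiating the logarithm in [KL] disappears in the
    centering. *)
Definition softmax_gradient p q r (lambda : R) z : R :=
  p z * (r z - lambda * ln (p z / q z) - regularized_reward p q r lambda).

(** The argument [z] witnesses that [Y] is nonempty. *)
Lemma sum_expR_gt0 th z : 0 < \sum_k expR (th k).
Proof.
by rewrite (bigD1 z)//= ltr_pwDl ?expR_gt0// sumr_ge0.
Qed.

Lemma softmax_gt0 th z : 0 < softmax th z.
Proof. by rewrite divr_gt0 ?expR_gt0// (sum_expR_gt0 th z). Qed.

Lemma sum_softmax th z : \sum_k softmax th k = 1.
Proof. by rewrite -mulr_suml divff// gt_eqF// (sum_expR_gt0 th z). Qed.

Lemma expectationB p f (k : R) : \sum_z p z = 1 ->
  \sum_z p z * (f z - k) = expectation p f - k.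
Proof.
move=> p1; under eq_bigr do rewrite mulrBr.
by rewrite sumrB -mulr_suml p1 mul1r.
Qed.

(* Both sides are the covariance of [v] and [f] when [p] has mass [1]. *)
Lemma covariance_sym p v f :
  \sum_z p z * (v z - expectation p v) * f z =
  \sum_z v z * (p z * (f z - expectation p f)).
Proof.
rewrite (eq_bigr (fun z => p z * v z * f z - expectation p v * (p z * f z))).
  rewrite [RHS](eq_bigr (fun z => p z * v z * f z - p z * v z * expectation p f)).
    by rewrite !sumrB -mulr_sumr -mulr_suml.
  by move=> z _; ring.
by move=> z _; ring.
Qed.

Lemma regularized_rewardE p q r (lambda : R) :
  regularized_reward p q r lambda =
  expectation p (fun z => r z - lambda * ln (p z / q z)).
Proof.
rewrite /regularized_reward /expectation /KL mulr_sumr -sumrB.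
by apply: eq_bigr => z _; ring.
Qed.

Lemma sum_softmax_gradient p q r (lambda : R) : \sum_z p z = 1 ->
  \sum_z softmax_gradient p q r lambda z = 0.
Proof. by move=> p1; rewrite expectationB// regularized_rewardE subrr. Qed.

Section Curve.
Variables (th : R -> Y -> R) (t : R) (v : Y -> R).
Hypothesis dth : forall z, is_derive t 1 (th^~ z) (v z).
Let p := softmax (th t).
Let p0 z : 0 < p z. Proof. exact: softmax_gt0. Qed.

Lemma is_derive_softmax z : is_derive t 1 (fun u => softmax (th u) z)
  (p z * (v z - expectation p v)).
Proof.
have S0 := sum_expR_gt0 (th t) z.
have dS : is_derive t 1 (fun u => \sum_k expR (th u k))
    (\sum_k expR (th t k) * v k).
  by apply: is_derive1_sum => k _; exact: is_derive1_expR_comp.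
have S0' : \sum_k expR (th t k) != 0 by rewrite gt_eqF.
apply: is_derive1_eq (is_derive1M (is_derive1_expR_comp (dth z))
  (is_derive1V S0' dS)) _ _ => //.
rewrite /expectation /p /softmax.
have -> : \sum_k expR (th t k) / (\sum_k expR (th t k)) * v k =
    (\sum_k expR (th t k) * v k) / (\sum_k expR (th t k)).
  by rewrite mulr_suml; apply: eq_bigr => k _; rewrite mulrAC.
by field.
Qed.

Lemma is_derive_expectation f :
  is_derive t 1 (fun u => expectation (softmax (th u)) f)
    (\sum_z v z * (p z * (f z - expectation p f))).
Proof.
rewrite -covariance_sym; apply: is_derive1_sum => z _.
exact/is_derive1Mr/is_derive_softmax.
Qed.

Lemma is_derive_ln_ratio q z : 0 < q z ->
  is_derive t 1 (fun u => ln (softmax (th u) z / q z)) (v z - expectation p v).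
Proof.
move=> q0; have pz := p0 z.
have pq : 0 < p z / q z by rewrite divr_gt0.
have d := is_derive1Mr (q z)^-1 (is_derive_softmax z).
apply: is_derive1_eq
  (is_derive1_ln_comp (f := fun u => softmax (th u) z / q z) pq d) _ _ => //=.
by rewrite -/p; field; rewrite !gt_eqF.
Qed.

Lemma is_derive_regularized_reward q r (lambda : R) : (forall z, 0 < q z) ->
  is_derive t 1 (fun u => regularized_reward (softmax (th u)) q r lambda)
    (\sum_z v z * softmax_gradient p q r lambda z).
Proof.
move=> q0.
have dKL : is_derive t 1 (fun u => KL (softmax (th u)) q)
    (\sum_z v z * (p z * (ln (p z / q z) - KL p q))).
  pose dKLz z := is_derive1M (is_derive_softmax z) (is_derive_ln_ratio (q0 z)).
  apply: is_derive1_eq (is_derive1_sum (P := predT) (fun z _ => dKLz z)) _ _ => //.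
  rewrite /=.
  (* If [Y] is empty, all sums are empty. Otherwise the derivative of the logarithm contributes a
     sum of centered terms under a distribution of mass 1, which is zero. *)
  have [z _|noY] := pickP (fun _ : Y => true); last by rewrite !big_pred0.
  rewrite big_split/= [X in _ + X]expectationB ?(sum_softmax _ z)// subrr addr0.
  exact: covariance_sym.
apply: is_derive1_eq (is_derive1B (is_derive_expectation r)
  (is_derive1Ml lambda dKL)) _ _ => //.
rewrite mulr_sumr -sumrB; apply: eq_bigr => z _.
by rewrite /softmax_gradient /regularized_reward -/p; ring.
Qed.

End Curve.
End Softmax.

(** * From the matrix gradient flow to an equation for the logits of one prompt *)

Section Flow.
Set Implicit Arguments.
Unset Strict Implicit.
Context {R : realType} {X Y : finType}.
Implicit Types (S : {set X}) (r : X -> Y -> R) (lambda : R).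

Lemma policy_gt0 (theta : 'M[R]_(#|Y|, #|X|)) x z : 0 < policy theta x z.
Proof. exact: (softmax_gt0 (fun k => theta (enum_rank k) (enum_rank x))). Qed.

Lemma sum_policy (theta : 'M[R]_(#|Y|, #|X|)) x (y : Y) : \sum_z policy theta x z = 1.
Proof. exact: (sum_softmax (fun k => theta (enum_rank k) (enum_rank x)) y). Qed.

Lemma derive_along_line m n (f : 'M[R]_(m, n) -> R) (a v : 'M[R]_(m, n)) :
  'D_v f a = 'D_1 (fun h : R => f (h *: v + a)) 0.
Proof.
rewrite /derive; congr (lim (_ @ 0^')); apply/funext => h /=.
by rewrite addr0 scale0r add0r [_%:A]mulr1.
Qed.

Lemma gradient_rlhf S r lambda (ref a : 'M[R]_(#|Y|, #|X|)) x z : x \in S ->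
  gradient (rlhf_objective S r lambda ref) a (enum_rank z) (enum_rank x) =
  #|S|%:R^-1 * softmax_gradient (policy a x) (policy ref x) (r x) lambda z.
Proof.
move=> xS; rewrite mxE derive_along_line.
set v := delta_mx _ _.
pose th x' (h : R) k := (h *: v + a) (enum_rank k) (enum_rank x').
have dth x' k : is_derive (0 : R) 1 ((th x')^~ k) (v (enum_rank k) (enum_rank x')).
  have := is_derive1D
    (is_derive1Mr (v (enum_rank k) (enum_rank x')) (is_derive_id (0 : R) (1 : R)))
    (is_derive_cst (a (enum_rank k) (enum_rank x')) (0 : R) (1 : R)).
  move=> H; apply: is_derive1_eq H _ _ => [h|]; first by rewrite /th !mxE.
  by rewrite mul1r addr0.
have d := is_derive1Ml #|S|%:R^-1 (is_derive1_sum (P := mem S) (fun x' _ =>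
  is_derive_regularized_reward (dth x') (r x') lambda (policy_gt0 ref x'))).
rewrite (derive_val (is_derive := d)); congr (_ * _).
have th0 x' : softmax (th x' 0) = policy a x'.
  by apply/funext => k; rewrite /softmax /th /policy scale0r add0r.
(* The direction [v] is nonzero only at output [z] of prompt [x]; every other term of the double sum
   vanishes. *)
rewrite (bigD1 x)//= (bigD1 z)//= th0 !mxE !eqxx mul1r.
rewrite big1 ?addr0 => [|k kz]; last first.
  by rewrite mxE (inj_eq enum_rank_inj) (negbTE kz) mul0r.
rewrite big1 ?addr0// => x' /andP[_ x'x]; rewrite big1// => k _.
by rewrite mxE (inj_eq enum_rank_inj x') (negbTE x'x) andbF mul0r.
Qed.

(* Extending the trajectory affinely to negative times makes it differentiable
   at [0], so that no one-sided derivative is needed afterwards. *)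
Lemma is_derive_extend_left m n (f : R -> 'M[R]_(m, n)) (g : 'M[R]_(m, n)) :
  h^-1 *: (f h - f 0) @[h --> 0^'+] --> g ->
  is_derive (0 : R) (1 : R) (fun t => if t < 0 then f 0 + t *: g else f t) g.
Proof.
move=> fg; set F := (fun t => _).
suff H : h^-1 *: ((F \o shift 0) (h *: 1) - F 0) @[h --> 0^'] --> g.
  by apply: DeriveDef; [apply/cvg_ex; exists g|exact: cvg_lim].
move=> A gA; have := fg A gA; rewrite /nbhs/= /at_right /within/= => Ar.
near=> h; have [h0|h0|h0] := ltgtP h 0.
- rewrite /F/= addr0 [h%:A]mulr1 ltxx h0 addrAC subrr add0r scalerA.
  by rewrite mulVf ?lt_eqF// scale1r; exact: nbhs_singleton.
- rewrite /F/= addr0 [h%:A]mulr1 ltxx ltNge (ltW h0)/=.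
  by move: h0; near: h; exact: nbhs_dnbhs Ar.
- exfalso; move/eqP: h0; apply/negP; near: h; exact: nbhs_dnbhs_neq.
Unshelve. all: by end_near. Qed.

Lemma gradient_flow_extend m n (phi : 'M[R]_(m, n) -> R) theta0 theta :
  gradient_flow phi theta0 theta -> exists2 th,
    (forall t, 0 <= t -> th t = theta t) &
    (forall t : R, 0 <= t -> is_derive t (1 : R) th (gradient phi (th t))).
Proof.
move=> [th0 right0 dtheta].
exists (fun t => if t < 0 then theta 0 + t *: gradient phi (theta 0) else theta t).
  by move=> t t0; rewrite ltNge t0.
move=> t; rewrite le_eqVlt => /predU1P[<-|t0].
  rewrite ltxx; exact: is_derive_extend_left.
rewrite ltNge (ltW t0)/=.
apply: near_eq_is_derive (dtheta t t0); near=> s.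
have s0 : 0 < s by near: s; exact: lt_nbhsr.
by rewrite ltNge (ltW s0).
Unshelve. all: by end_near. Qed.

(** The equation for the column of [x] is autonomous: the other prompts enter only through the
    factor [1/|S|]. The curve [th] comes from the extended trajectory, hence is two-sided
    differentiable at time [0] as well. *)
Lemma rlhf_flow_policy S r lambda theta0 theta x : x \in S ->
  rlhf_flow S r lambda theta0 theta ->
  exists th : R -> Y -> R,
  [/\ forall t, 0 <= t -> policy (theta t) x = softmax (th t),
      policy theta0 x = softmax (th 0) &
      forall (t : R) z, 0 <= t -> is_derive t 1 (th^~ z)
        (#|S|%:R^-1 * softmax_gradient (softmax (th t)) (softmax (th 0)) (r x) lambda z)].
Proof.
move=> xS fl; have [E0 _ _] := fl.
have [th thE dth] := gradient_flow_extend fl.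
have th0 : th 0 = theta0 by rewrite thE.
exists (fun t k => th t (enum_rank k) (enum_rank x)); split.
- by move=> t t0; rewrite -thE.
- by rewrite -th0.
move=> t z t0; have [dt vt] := dth t t0.
have := derive_mx dt; rewrite vt => /matrixP/(_ (enum_rank z) (enum_rank x)).
rewrite gradient_rlhf// mxE -th0 => E.
rewrite [X in is_derive _ _ _ X]E.
by apply: DeriveDef => //; move/derivable_mxP: dt; exact.
Qed.

End Flow.

(** * Entropy, variance and Markov inequalities for finite distributions *)

Section Distributions.
Set Implicit Arguments.
Unset Strict Implicit.
Context {R : realType} {Y : finType}.
Implicit Types (p q v f : Y -> R) (y z : Y).

Lemma ln_le_subr1 (a : R) : 0 < a -> ln a <= a - 1.
Proof.
by move=> a0; rewrite -[in leLHS](subrKC 1 a); apply: le_ln1Dx; lra.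
Qed.

(** Tangent of [x ln x] at [x = k], taken at [x = a / b] and scaled by [b]; it is [ln s <= s - 1] at
    [s = k b / a]. *)
Lemma mul_ln_ratio_ge (a b k : R) : 0 < a -> 0 < b -> 0 < k ->
  a - k * b <= a * (ln (a / b) - ln k).
Proof.
move=> a0 b0 k0.
have := ln_le_subr1 (a := k * b / a) (divr_gt0 (mulr_gt0 k0 b0) a0).
rewrite !(lnM, lnV) ?posrE ?mulr_gt0 ?invr_gt0// => H.
have -> : a - k * b = a * (1 - k * b / a) by field; rewrite gt_eqF.
by rewrite ler_pM2l//; move: H; rewrite ?(lnM, lnV) ?posrE ?invr_gt0//; lra.
Qed.

(** The terms [- a + b] cancel in the sum over the outputs, yet make each summand of [KL]
    nonnegative, which termwise estimates need. *)
Lemma relative_entropy_term_ge0 (a b : R) : 0 < a -> 0 < b ->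
  0 <= a * ln (a / b) - a + b.
Proof. by move=> a0 b0; have := mul_ln_ratio_ge a0 b0 ltr01; rewrite ln1; lra. Qed.

(** From [exp(1/3) >= 4/3] follows [exp(4/3) >= (4/3)^4 = 256/81 > 3]. *)
Lemma ln3_le : ln 3 <= 4 / 3 :> R.
Proof.
rewrite -(@expRK R (4 / 3)) ler_ln ?posrE ?expR_gt0//.
rewrite expRM_natl.
have H : 4 / 3 <= expR 3^-1 :> R by apply: le_trans (expR_ge1Dx _); lra.
by apply: le_trans (lerXn2r 4 _ _ H); rewrite ?nnegrE ?expR_ge0//; lra.
Qed.

(** From [exp(-1/6) >= 5/6] and [(5/6)^6 = 15625/46656 > 1/3]. *)
Lemma expRN1_ge : 3^-1 <= expR (- 1) :> R.
Proof.
have -> : - 1 = 6%:R * - 6^-1 :> R by field.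
rewrite expRM_natl.
have H : 5 / 6 <= expR (- 6^-1) :> R by apply: le_trans (expR_ge1Dx _); lra.
by apply: le_trans (lerXn2r 6 _ _ H); rewrite ?nnegrE ?expR_ge0//; lra.
Qed.

(* This is [3 x ln x + x + 1 >= 0] at [x = a / b], obtained from the tangent
   of [x ln x] at [x = 1/3]. *)
Lemma relative_entropy_slope_le (a b : R) : 0 < a -> 0 < b ->
  - (a * (1 + ln (a / b))) <= (a * ln (a / b) - a + b) / 2.
Proof.
move=> a0 b0; have k0 : 0 < 3^-1 :> R by [].
have := mul_ln_ratio_ge a0 b0 k0; rewrite lnV ?posrE// => H.
have : a * ln 3 <= a * (4 / 3) by rewrite ler_pM2l// ln3_le.
by lra.
Qed.

Lemma sum_relative_entropy_term p q : \sum_z p z = 1 -> \sum_z q z = 1 ->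
  \sum_z (p z * ln (p z / q z) - p z + q z) = KL p q.
Proof. by move=> p1 q1; rewrite big_split sumrB/= p1 q1 subrK. Qed.

Lemma KL_ge0 p q : (forall z, 0 < p z) -> (forall z, 0 < q z) ->
  \sum_z p z = 1 -> \sum_z q z = 1 -> 0 <= KL p q.
Proof.
move=> p0 q0 p1 q1; rewrite -sum_relative_entropy_term// sumr_ge0// => z _.
exact: relative_entropy_term_ge0.
Qed.

Lemma KL_id p : KL p p = 0.
Proof.
rewrite /KL big1// => z _; have [->|pz] := eqVneq (p z) 0; first by rewrite mul0r.
by rewrite divff// ln1 mulr0.
Qed.

Lemma prob_le1 p z : (forall k, 0 <= p k) -> \sum_k p k = 1 -> p z <= 1.
Proof. by move=> p0 <-; rewrite (bigD1 z)//= lerDl sumr_ge0. Qed.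

Lemma sqr_expectation_le p v : (forall z, 0 <= p z) -> \sum_z p z = 1 ->
  expectation p v ^+ 2 <= expectation p (fun z => v z ^+ 2).
Proof.
move=> p0 p1; set m := expectation p v.
have : 0 <= \sum_z p z * (v z - m) ^+ 2.
  by apply: sumr_ge0 => z _; rewrite mulr_ge0 ?sqr_ge0.
rewrite (eq_bigr (fun z => p z * v z ^+ 2 - 2 * m * (p z * v z) + m ^+ 2 * p z)).
  rewrite big_split sumrB/= -!mulr_sumr p1 -/(expectation p v) -/m.
  rewrite /expectation -/(expectation p v) -/m.
  by move: m (\sum_y _) => m e; lra.
by move=> z _; ring.
Qed.

(** Jensen's inequality for [v z - v k], then [(a - b)^2 <= 2 (a^2 + b^2)]; the factor does not
    depend on [p]. *)
Lemma centered_sqr_le p v z : (forall k, 0 <= p k) -> \sum_k p k = 1 ->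
  (v z - expectation p v) ^+ 2 <= 2 * \sum_k v k ^+ 2.
Proof.
move=> p0 p1.
have -> : v z - expectation p v = expectation p (fun k => v z - v k).
  rewrite /expectation [RHS](eq_bigr (fun k => p k * v z - p k * v k)).
    by rewrite sumrB -mulr_suml p1 mul1r.
  by move=> k _; ring.
apply: le_trans (sqr_expectation_le _ p0 p1) _.
rewrite -[leRHS]mul1r -[X in _ <= X * _]p1 mulr_suml ler_sum// => k _; rewrite ler_wpM2l//.
have [->|kz] := eqVneq k z.
  by rewrite subrr expr0n/= mulr_ge0 ?sumr_ge0// => i _; exact: sqr_ge0.
rewrite (bigD1 z)//= (bigD1 k)//=.
have : 0 <= \sum_(i | (i != z) && (i != k)) v i ^+ 2.
  by apply: sumr_ge0 => i _; exact: sqr_ge0.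
by have := sqr_ge0 (v z + v k); nra.
Qed.

(** Markov's inequality for the nonnegative function [f + 1]. *)
Lemma mul_succ_le_expectation p f y : (forall z, 0 <= p z) -> \sum_z p z = 1 ->
  (forall z, -1 <= f z) -> p y * (f y + 1) <= expectation p f + 1.
Proof.
move=> p0 p1 f1; rewrite -[X in _ <= _ + X]p1 /expectation -big_split (bigD1 y)//=.
rewrite mulrDr mulr1 lerDl; apply: sumr_ge0 => z _.
by rewrite -[X in _ + X]mulr1 -mulrDr mulr_ge0//; have := f1 z; lra.
Qed.

End Distributions.

(** * First and second order identities along the flow, for any reward *)

Section SoftmaxFlow.
Set Implicit Arguments.
Unset Strict Implicit.
Context {R : realType} {Y : finType}.
Implicit Types (t : R) (y z : Y).
Variables (th : R -> Y -> R) (sigma lambda : R) (r : Y -> R).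
Let p t := softmax (th t).
Let w t := softmax_gradient (p t) (p 0) r lambda.
Let wbar t := expectation (p t) (w t).
Let N t := \sum_z w t z ^+ 2.
Hypothesis dth : forall (t : R) z, 0 <= t ->
  is_derive t 1 (th^~ z) (sigma * w t z).

Let p_gt0 t z : 0 < p t z. Proof. exact: softmax_gt0. Qed.

Let expectation_sigma t : expectation (p t) (fun z => sigma * w t z) = sigma * wbar t.
Proof. by rewrite /expectation mulr_sumr; apply: eq_bigr => z _; rewrite mulrCA. Qed.

Lemma is_derive_prob t z : 0 <= t ->
  is_derive t 1 (fun u => p u z) (sigma * (p t z * (w t z - wbar t))).
Proof.
move=> t0; apply: is_derive1_eq (is_derive_softmax (fun k => dth k t0) z) _ _ => //.
by rewrite -/(p t) expectation_sigma; ring.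
Qed.

Lemma is_derive_reward t : 0 <= t ->
  is_derive t 1 (fun u => regularized_reward (p u) (p 0) r lambda) (sigma * N t).
Proof.
move=> t0; have d := is_derive_regularized_reward (fun k => dth k t0) r lambda (p_gt0 0).
apply: is_derive1_eq d _ _ => //.
by rewrite /N mulr_sumr; apply: eq_bigr => z _; rewrite -/(w t) expr2 mulrA.
Qed.

Lemma is_derive_gradient t z : 0 <= t ->
  is_derive t 1 (fun u => w u z)
   (sigma * (w t z * (w t z - wbar t) - p t z * (lambda * (w t z - wbar t) + N t))).
Proof.
move=> t0.
have dL := is_derive1Ml lambda (is_derive_ln_ratio (fun k => dth k t0) (p_gt0 0 z)).
have dg := is_derive1B (is_derive1B (is_derive_cst (r z) t (1 : R)) dL) (is_derive_reward t0).
apply: is_derive1_eq (is_derive1M (is_derive_prob z t0) dg) _ _ => //.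
rewrite -/(p t) expectation_sigma /= /w /softmax_gradient -/(wbar t) -/(w t).
move: (N t) (wbar t) => n b. ring.
Qed.

(** The sum is the Hessian of the regularized reward applied twice to [w]. *)
Lemma is_derive_sqr_gradient t y : 0 <= t -> is_derive t 1 N
  (2 * sigma * \sum_z (w t z - wbar t) ^+ 2 * (w t z - lambda * p t z)).
Proof.
move=> t0.
have d := is_derive1_sum (P := predT) (fun z _ =>
   is_derive1M (is_derive_gradient z t0) (is_derive_gradient z t0)).
apply: is_derive1_eq d _ _ => [u|]; first by apply: eq_bigr => z _; rewrite expr2.
have w0 : \sum_z w t z = 0 by rewrite sum_softmax_gradient// (sum_softmax _ y).
have p1 : \sum_z p t z = 1 by rewrite (sum_softmax _ y).
(* After isolating the square of [w - wbar], the five remaining sums cancel: [w] sums to 0, [p] to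
   1, [p w] to [wbar] and [w^2] to [N]. *)
rewrite (eq_bigr (fun z => 2 * sigma * ((w t z - wbar t) ^+ 2 * (w t z - lambda * p t z))
  + 2 * sigma * wbar t * (w t z ^+ 2) - 2 * sigma * wbar t ^+ 2 * w t z
  - 2 * sigma * wbar t * lambda * (p t z * w t z)
  + 2 * sigma * wbar t ^+ 2 * lambda * p t z
  - 2 * sigma * N t * (p t z * w t z))); last by move=> z _; ring.
rewrite !(sumrB, big_split)/= -!mulr_sumr w0 p1 -/(wbar t) -/(N t).
rewrite -/(expectation (p t) (w t)) -/(wbar t).
ring.
Qed.

End SoftmaxFlow.

(** * Pointwise estimates for the reward concentrated on one output *)

Section Spike.
Set Implicit Arguments.
Unset Strict Implicit.
Context {R : realType} {Y : finType}.
Implicit Types (y z : Y).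

(* The proof of the lower time bound tolerates heights up to about [0.628], that
   of the upper bound heights from [1/2 + 1/8], [1/8] being lost to the KL term. *)
Definition spike y z : R := if z == y then 5 / 8 else 0.

Lemma expectation_spike (p : Y -> R) y : expectation p (spike y) = p y * (5 / 8).
Proof.
rewrite /expectation (bigD1 y)//= /spike eqxx big1 ?addr0// => z /negbTE ->.
exact: mulr0.
Qed.

Section Static.
Variables (p q : Y -> R) (lambda : R) (y : Y).
Hypotheses (p_gt0 : forall z, 0 < p z) (q_gt0 : forall z, 0 < q z).
Hypotheses (p1 : \sum_z p z = 1) (q1 : \sum_z q z = 1).
Hypothesis lambda_ge0 : 0 <= lambda.
Let p_ge0 z : 0 <= p z. Proof. exact/ltW. Qed.
Let w := softmax_gradient p q (spike y) lambda.
Let wbar := expectation p w.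
Let N := \sum_z w z ^+ 2.

(** The left-hand side contains [- lambda * p z * (1 + ln (p z / q z))], controlled by
    [relative_entropy_slope_le]. At [y] the logarithm is nonnegative and the reward adds
    [5/8 * p y]; the remaining mean term is nonpositive by the bound on [lambda * KL]. *)
Lemma spike_curvature_coef_le z : q y <= p y -> lambda * KL p q <= 5 / 8 * p y ->
  w z - lambda * p z <= (if z == y then 5 / 8 * p y else 0)
     + lambda / 2 * (p z * ln (p z / q z) - p z + q z).
Proof.
move=> qp lKL; rewrite /w /softmax_gradient /regularized_reward expectation_spike.
have h := relative_entropy_slope_le (p_gt0 z) (q_gt0 z).
have h0 := relative_entropy_term_ge0 (p_gt0 z) (q_gt0 z).
have pKL : p z * (lambda * KL p q - 5 / 8 * p y) <= 0.
  by rewrite mulr_ge0_le0// subr_le0.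
rewrite /spike; case: eqP => [zy|_].
  have l0 : 0 <= ln (p z / q z).
    by rewrite zy ln_ge0// ler_pdivlMr ?mul1r.
  have := mulr_ge0 (mulr_ge0 lambda_ge0 (p_ge0 z)) l0.
  have := mulr_ge0 lambda_ge0 h0.
  have := mulr_ge0 lambda_ge0 (p_ge0 z).
  by rewrite -zy in pKL *; lra.
have := ler_wpM2l lambda_ge0 h; lra.
Qed.

(* The left-hand side is the Hessian of the regularized reward in direction [w].
   The bound does not involve [lambda]: the coefficients of the squares are
   dominated by the terms of [lambda / 2 * KL], up to the one of [y]. *)
Lemma spike_curvature_le : q y <= p y -> lambda * KL p q <= 5 / 8 * p y ->
  \sum_z (w z - wbar) ^+ 2 * (w z - lambda * p z) <= 15 / 8 * p y * N.
Proof.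
move=> qp lKL.
have N0 : 0 <= N by apply: sumr_ge0 => z _; exact: sqr_ge0.
pose h z := p z * ln (p z / q z) - p z + q z.
pose a z := (if z == y then 5 / 8 * p y else 0) + lambda / 2 * h z.
have a0 z : 0 <= a z.
  rewrite addr_ge0 ?mulr_ge0 ?divr_ge0 ?relative_entropy_term_ge0//.
  by case: ifP => // _; rewrite mulr_ge0.
have sa : \sum_z a z = 5 / 8 * p y + lambda / 2 * KL p q.
  by rewrite big_split/= -big_mkcond big_pred1_eq -mulr_sumr sum_relative_entropy_term.
apply: (@le_trans _ _ (\sum_z 2 * N * a z)).
  apply: ler_sum => z _; apply: le_trans (_ : (w z - wbar) ^+ 2 * a z <= _).
    by rewrite ler_wpM2l ?sqr_ge0// spike_curvature_coef_le.
  by rewrite ler_wpM2r// centered_sqr_le.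
rewrite -mulr_sumr sa.
by have := ler_wpM2l N0 lKL; lra.
Qed.

(** When [p = q] the logarithms vanish and [w z] is [5/8 * p z * ([z = y] - p y)], whatever [lambda]
    is. *)
Lemma spike_initial_sqr_gradient_le : p = q -> N <= 25 / 32 * p y ^+ 2.
Proof.
move=> pq; have KL0 : KL p q = 0 by rewrite pq KL_id.
have -> : N = \sum_z (if z == y then 25 / 64 * (p y ^+ 2 - 2 * p y ^+ 3) else 0)
     + 25 / 64 * p y ^+ 2 * \sum_z p z ^+ 2.
  rewrite mulr_sumr -big_split; apply: eq_bigr => z _.
  rewrite /w /softmax_gradient /regularized_reward KL0 expectation_spike -pq.
  rewrite divff ?gt_eqF// ln1 /spike /=; by case: eqP => [->|_]; field.
rewrite -big_mkcond big_pred1_eq.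
have p2 : \sum_z p z ^+ 2 <= 1.
  rewrite -p1 ler_sum// => z _; rewrite expr2 ler_piMr// prob_le1//.
have := ler_wpM2l (sqr_ge0 (p y)) p2.
by have := exprn_ge0 3 (p_ge0 y); lra.
Qed.

(** Splitting off [y] in the mean, [w y - wbar] is [(1 - p y) * w y] minus the sum of [p z * w z]
    over the other outputs. The KL part costs at most [lambda * M] in the former; in the latter [M]
    bounds [KL] and [exp(-1)] bounds [- p ln p]. *)
Lemma spike_drift_ge (M : R) : (forall z, - ln (q z) <= M) ->
  (1 - p y) * (5 / 8 * p y * (1 - p y) - lambda * (2 * M + expR (- 1))) <= w y - wbar.
Proof.
move=> qM.
have p_le1 z : p z <= 1 by exact: prob_le1.
have q_le1 z : q z <= 1 by apply: prob_le1 => // k; exact: ltW.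
have lM z : ln (p z / q z) <= M.
  rewrite ln_div ?posrE//; have := qM z; have := ln_le0 (p_le1 z); lra.
have M0 : 0 <= M.
  by apply: le_trans (qM y); rewrite oppr_ge0 ln_le0.
have KL0 : 0 <= KL p q by exact: KL_ge0.
have KLM : KL p q <= M.
  rewrite -[M]mul1r -[X in _ <= X * _]p1 mulr_suml ler_sum// => z _.
  by rewrite ler_wpM2l.
have wyE : p y * (5 / 8 * (1 - p y)) - lambda * M <= w y.
  rewrite /w /softmax_gradient /regularized_reward expectation_spike /spike eqxx.
  have H1 := mulr_ge0 (p_ge0 y) (mulr_ge0 lambda_ge0 KL0).
  have H2 := ler_wpM2l (p_ge0 y) (ler_wpM2l lambda_ge0 (lM y)).
  have H3 := ler_wpM2r (mulr_ge0 lambda_ge0 M0) (p_le1 y).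
  by lra.
have wzE z : z != y -> w z <= lambda * (expR (- 1) + M).
  move=> zy; rewrite /w /softmax_gradient /regularized_reward expectation_spike.
  rewrite /spike (negbTE zy).
  have H1 : p z * (- ln (p z / q z)) <= expR (- 1).
    have := mul_ln_ratio_ge (p_gt0 z) ltr01 (expR_gt0 (- 1)).
    rewrite divr1 expRK ln_div ?posrE//.
    have : p z * ln (q z) <= 0 by rewrite mulr_ge0_le0// ln_le0.
    by lra.
  have H2 : p z * KL p q <= M.
    by apply: le_trans KLM; rewrite ler_piMl.
  have H3 := mulr_ge0 (p_ge0 z) (p_ge0 y).
  have H4 := ler_wpM2l lambda_ge0 H1.
  have H5 := ler_wpM2l lambda_ge0 H2.
  by lra.
have sp : \sum_(z | z != y) p z = 1 - p y.
  by rewrite -p1 [in RHS](bigD1 y)//= addrAC subrr add0r.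
have : \sum_(z | z != y) p z * w z <= (1 - p y) * (lambda * (expR (- 1) + M)).
  rewrite -sp mulr_suml ler_sum// => z zy.
  by rewrite ler_wpM2l// wzE.
have p1y : 0 <= 1 - p y by rewrite subr_ge0.
have H := ler_wpM2l p1y wyE.
by rewrite /wbar /expectation [X in _ -> _ <= _ - X](bigD1 y)//=; lra.
Qed.

End Static.
End Spike.

(** * The flow for a spike reward *)

Section SpikeFlow.
Set Implicit Arguments.
Unset Strict Implicit.
Context {R : realType} {Y : finType}.
Implicit Types (t u : R) (z : Y).
Variables (th : R -> Y -> R) (sigma lambda : R) (y : Y).
Let p t := softmax (th t).
Let w t := softmax_gradient (p t) (p 0) (spike y) lambda.
Let wbar t := expectation (p t) (w t).
Let N t := \sum_z w t z ^+ 2.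
Hypothesis sigma_gt0 : 0 < sigma.
Hypothesis lambda_ge0 : 0 <= lambda.
Hypothesis dth : forall t z, 0 <= t ->
  is_derive t 1 (th^~ z) (sigma * w t z).

Let p_gt0 t z : 0 < p t z. Proof. exact: softmax_gt0. Qed.
Let p_ge0 t z : 0 <= p t z. Proof. exact/ltW/p_gt0. Qed.
Let p1 t : \sum_z p t z = 1. Proof. exact: sum_softmax y. Qed.
Let N_ge0 t : 0 <= N t. Proof. by apply: sumr_ge0 => z _; exact: sqr_ge0. Qed.
Let KL_p_ge0 t : 0 <= KL (p t) (p 0). Proof. exact: KL_ge0. Qed.

(** The regularized reward does not decrease along its gradient flow, and [KL] vanishes at time
    [0]. *)
Lemma spike_flow_KL_le t : 0 <= t ->
  lambda * KL (p t) (p 0) <= 5 / 8 * (p t y - p 0 y).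
Proof.
move=> t0.
have d u : 0 <= u <= t -> is_derive u 1
    (fun u => - regularized_reward (p u) (p 0) (spike y) lambda) (- (sigma * N u)).
  by move=> /andP[u0 _]; apply: is_deriveN; exact: is_derive_reward.
have := is_derive1_nincr t0 d.
rewrite /regularized_reward !expectation_spike KL_id mulr0 => H.
suff : - (p t y * (5 / 8) - lambda * KL (p t) (p 0)) <= - (p 0 y * (5 / 8) - 0).
  by lra.
by apply: H => u _; rewrite oppr_le0 mulr_ge0// ltW.
Qed.

Lemma spike_flow_prob_ge t : 0 <= t -> p 0 y <= p t y.
Proof.
move=> t0; have := spike_flow_KL_le t0.
have : 0 <= lambda * KL (p t) (p 0) by rewrite mulr_ge0.
by lra.
Qed.

Lemma spike_flow_curvature t : 0 <= t ->
  \sum_z (w t z - wbar t) ^+ 2 * (w t z - lambda * p t z) <= 15 / 8 * p t y * N t.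
Proof.
move=> t0; apply: spike_curvature_le => //; first exact: spike_flow_prob_ge.
by apply: le_trans (spike_flow_KL_le t0) _; have := p_ge0 0 y; lra.
Qed.

(** Uses only [2 <= (377/200)^2]. *)
Let centered_le t z (d : R) : 0 < d -> N t * d ^+ 2 <= 1 ->
  `|w t z - wbar t| * d <= 377 / 200.
Proof.
move=> d0 Nd.
have H := @centered_sqr_le R Y (p t) (w t) z (p_ge0 t) (p1 t).
have : (`|w t z - wbar t| * d) ^+ 2 <= (377 / 200) ^+ 2.
  rewrite exprMn real_normK ?num_real//.
  apply: le_trans (_ : 2 * N t * d ^+ 2 <= _); first by rewrite ler_wpM2r ?sqr_ge0.
  by rewrite -mulrA; lra.
by rewrite ler_pXn2r ?nnegrE ?mulr_ge0 ?(ltW d0).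
Qed.

(** * Slow growth from a small initial probability, uniformly in [lambda] *)

Section Slow.
Variables (T2 b : R).
Hypothesis b_ge0 : 0 <= b.
Hypothesis T2_ge : 1 <= T2.
Hypothesis p0y : p 0 y * T2 <= 1.
(* The constants [omega = 377 / 200] and [eta = 201 / 200] satisfy
   [1 < eta], [15 / 4 * eta <= 2 * omega] and [2 <= omega ^ 2 <= 32 / 9]. *)
Let d t := T2 - 377 / 200 * sigma * t.
Hypothesis db : 0 < d b.

Let d_gt0 t : t <= b -> 0 < d t.
Proof.
move=> tb; apply: lt_le_trans db _.
by rewrite /d lerD2l lerN2 ler_wpM2l// mulr_ge0// ltW.
Qed.

Let dd t : is_derive t 1 d (- (377 / 200 * sigma)).
Proof.
apply: is_derive1_eq (is_derive1B (is_derive_cst T2 t (1 : R))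
  (is_derive1Ml (377 / 200 * sigma) (is_derive_id t (1 : R)))) _ _ => //.
by rewrite mulr1 sub0r.
Qed.

Let dprob t : 0 <= t -> is_derive t 1 (fun u => p u y * d u - 201 / 200)
  (sigma * p t y * ((w t y - wbar t) * d t - 377 / 200)).
Proof.
move=> t0.
have H := is_derive1B (is_derive1M (is_derive_prob dth y t0) (dd t))
  (is_derive_cst (201 / 200 : R) t (1 : R)).
apply: is_derive1_eq H _ _ => //.
by rewrite -/(p t) -/(w t) -/(wbar t); ring.
Qed.

Let dsqr t : 0 <= t -> is_derive t 1 (fun u => N u * d u ^+ 2 - 1)
  (2 * sigma * d t * ((\sum_z (w t z - wbar t) ^+ 2 * (w t z - lambda * p t z)) * d t
     - 377 / 200 * N t)).
Proof.
move=> t0.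
have H := is_derive1B (is_derive1M (is_derive_sqr_gradient dth y t0)
  (is_derive1M (dd t) (dd t))) (is_derive_cst (1 : R) t (1 : R)).
apply: is_derive1_eq H _ _ => //.
by rewrite -/(p t) -/(w t) -/(wbar t) -/(N t); ring.
Qed.

(** The two bounds support each other: the one on [N] limits the growth of [p], the one on [p]
    limits the growth of [N]. Hence a single barrier for the maximum of both. *)
Lemma slow_spike_flow_bound t : 0 <= t <= b ->
  p t y * d t < 201 / 200 /\ N t * d t ^+ 2 < 1.
Proof.
pose f t := p t y * d t - 201 / 200; pose g t := N t * d t ^+ 2 - 1.
have d0 : d 0 = T2 by rewrite /d mulr0 subr0.
(* Strictness at time [0] comes from [1 < 201/200] here and from [25/32 < 1] for [g]. *)
have f0 : f 0 < 0 by rewrite /f d0; have := p0y; lra.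
have g0 : g 0 < 0.
  rewrite /g d0.
  have := spike_initial_sqr_gradient_le lambda y (p_gt0 0) (p1 0) (erefl (p 0)).
  rewrite -/(w 0) -/(N 0) => HN.
  have := ler_wpM2r (sqr_ge0 T2) HN.
  have : (p 0 y * T2) ^+ 2 <= 1.
    by apply: exprn_ile1 => //; apply: mulr_ge0 => //; exact: le_trans ler01 T2_ge.
  by rewrite exprMn; lra.
move=> tb.
suff : Num.max (f t) (g t) < 0.
  by rewrite gt_max /f /g => /andP[]; lra.
move: t tb; apply: (@continuous_barrier R (f \max g) b).
  move=> t /andP[t0 _]; apply: continuous_max.
    exact: is_derive1_continuous (dprob t0).
  exact: is_derive1_continuous (dsqr t0).
move=> t /andP[t0 tb] H.
have ddt u : u < t -> 0 < d u by move=> ut; apply: d_gt0; lra.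
have fg u : 0 <= u < t -> p u y * d u <= 201 / 200 /\ N u * d u ^+ 2 <= 1.
  by move=> /H; rewrite /= gt_max /f /g => /andP[]; lra.
rewrite /= gt_max; apply/andP; split.
  (* The logarithmic derivative of [p] is at most [377/200 * sigma / d], the rate at which [d]
     decays, so [p * d] does not increase. *)
  apply: le_lt_trans f0; apply: (is_derive1_nincr t0 (fun u H => dprob (andP H).1)).
  move=> u ut; have [_ Nu] := fg u ut; case/andP: ut => u0 ut.
  apply: mulr_ge0_le0; first by apply: mulr_ge0; rewrite ?(ltW sigma_gt0).
  rewrite subr_le0; apply: le_trans (centered_le y (ddt u ut) Nu).
  by rewrite ler_wpM2r ?ler_norm// ltW// ddt.
(* The curvature bound and [p * d <= 201/200] leave [15/8 * 201/200 <= 377/200]. *)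
apply: le_lt_trans g0; apply: (is_derive1_nincr t0 (fun u H => dsqr (andP H).1)).
move=> u ut; have [pu _] := fg u ut; case/andP: ut => u0 ut.
have du := ltW (ddt u ut).
rewrite mulr_ge0_le0 ?mulr_ge0 ?(ltW sigma_gt0)// subr_le0.
apply: le_trans (ler_wpM2r du (spike_flow_curvature u0)) _.
by have := ler_wpM2l (N_ge0 u) pu; have := N_ge0 u; lra.
Qed.

(** As [f] is bounded by 1, its expectation has speed at most [377/200 * sigma / d], which is minus
    the derivative of [ln d]. *)
Lemma slow_spike_flow_expectation f : (forall z, -1 <= f z <= 1) ->
  expectation (p b) f + ln (d b) <= expectation (p 0) f + ln T2.
Proof.
move=> f1.
have d0 : d 0 = T2 by rewrite /d mulr0 subr0.
rewrite -[in leRHS]d0.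
have dE u : 0 <= u <= b -> is_derive u 1 (fun u => expectation (p u) f + ln (d u))
    (sigma * \sum_z p u z * (w u z - wbar u) * f z + - (377 / 200 * sigma) / d u).
  move=> /andP[u0 ub].
  have H : is_derive u 1 (fun u => expectation (p u) f)
      (\sum_z (sigma * (p u z * (w u z - wbar u))) * f z).
    by apply: is_derive1_sum => z _; apply: is_derive1Mr; exact: is_derive_prob.
  apply: is_derive1_eq (is_derive1D H (is_derive1_ln_comp (d_gt0 ub) (dd u))) _ _ => //.
  by congr (_ + _); rewrite mulr_sumr; apply: eq_bigr => z _; ring.
apply: (is_derive1_nincr b_ge0 dE) => u ub.
have ub' : 0 <= u <= b by case/andP: ub => -> /ltW.
have [_ Nu] := slow_spike_flow_bound ub'.
have du : 0 < d u by apply: d_gt0; case/andP: ub'.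
have -> : - (377 / 200 * sigma) / d u = - (sigma * (377 / 200 / d u)).
  by field; rewrite gt_eqF.
rewrite subr_le0 ler_wpM2l ?(ltW sigma_gt0)//.
rewrite -[leRHS]mul1r -[X in _ <= X * _](p1 u) mulr_suml ler_sum// => z _.
rewrite -mulrA ler_wpM2l// ler_pdivlMr//.
apply: le_trans (centered_le z du (ltW Nu)).
rewrite ler_wpM2r ?(ltW du)//.
apply: le_trans (ler_norm _) _; rewrite normrM ler_piMr//.
by rewrite ler_norml.
Qed.

End Slow.

(** * Fast growth from an initial probability at least [c], for small [lambda] *)

Section Fast.
Variables (M c rho b : R).
Hypothesis p0M : forall z, - ln (p 0 z) <= M.
Hypotheses (c_gt0 : 0 < c) (p0c : c <= p 0 y) (rho01 : 0 < rho < 1).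
Hypothesis lambda_le : lambda * (2 * M + expR (- 1)) <= c * (1 - rho) ^+ 3 / 8.
Hypothesis bE : sigma * b * (1 - rho) ^+ 3 / 2 = c^-1 - rho^-1.
Hypothesis b_ge0 : 0 <= b.

(* Used with [k = 2], where [p >= c / 2] suffices, to show that [p] never drops
   below [c], and then with [k = 1] for the rate. *)
Let drift_ge (k : R) u : 0 <= u -> 0 < k -> c <= k * p u y -> p u y < rho ->
  p u y * (1 - p u y) ^+ 2 * (5 / 8 - k / 8) <= w u y - wbar u.
Proof.
move=> u0 k0 ck pr.
have := spike_drift_ge y (p_gt0 u) (p_gt0 0) (p1 u) (p1 0) lambda_ge0 p0M.
apply: le_trans.
have a0 : 0 < 1 - rho by case/andP: rho01; lra.
have ak : 1 - rho <= 1 - p u y by lra.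
have k1 : 1 - p u y <= 1 by have := p_ge0 u y; lra.
have -> : p u y * (1 - p u y) ^+ 2 * (5 / 8 - k / 8) =
  (1 - p u y) * (5 / 8 * p u y * (1 - p u y) - k * p u y * (1 - p u y) / 8) by ring.
apply: ler_wpM2l; first by lra.
rewrite lerD2l lerN2; apply: le_trans lambda_le _.
rewrite ler_wpM2r//; apply: ler_pM => //; [exact: ltW|exact/exprn_ge0/ltW|].
apply: le_trans ak; rewrite exprS ler_piMr ?(ltW a0)// exprn_ile1 ?(ltW a0)//.
by case/andP: rho01; lra.
Qed.

(** Suppose [p < rho] up to time [b]. A barrier at [c / 2] makes the drift nonnegative, which then
    gives [p >= c]. With this, [1/p] loses at least [sigma (1 - rho)^3 / 2] per unit of time, hence
    falls from at most [1/c] to at most [1/rho] at time [b]. *)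
Lemma fast_spike_flow : exists2 t, 0 <= t <= b & rho <= p t y.
Proof.
apply: contrapT => nex.
have pr u : 0 <= u <= b -> p u y < rho.
  by move=> ub; rewrite ltNge; apply/negP => H; apply: nex; exists u.
have dp u : 0 <= u -> is_derive u 1 (fun u => c / 2 - p u y)
    (- (sigma * (p u y * (w u y - wbar u)))).
  move=> u0; have H := is_derive1B (is_derive_cst (c / 2) u (1 : R)) (is_derive_prob dth y u0).
  by apply: is_derive1_eq H _ _ => //; rewrite sub0r.
have mono u : 0 <= u <= b -> (forall v, 0 <= v < u -> c / 2 - p v y < 0) ->
    c / 2 - p u y <= c / 2 - p 0 y.
  move=> /andP[u0 ub] H.
  apply: (is_derive1_nincr u0 (fun v H => dp v (andP H).1)) => v vu.
  have := H v vu; case/andP: vu => v0 vu pv.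
  rewrite oppr_le0; apply: mulr_ge0; first exact: ltW.
  apply: mulr_ge0 => //.
  have k2 : 0 < 2 :> R by [].
  have cp : c <= 2 * p v y by lra.
  have pvr : p v y < rho by apply: pr; rewrite v0 (le_trans (ltW vu)).
  apply: le_trans _ (drift_ge v0 k2 cp pvr).
  by apply: mulr_ge0; [apply: mulr_ge0 => //; exact: sqr_ge0|lra].
have half u : 0 <= u <= b -> c / 2 - p u y < 0.
  move: u; apply: (@continuous_barrier R (fun u => c / 2 - p u y) b).
    move=> v /andP[v0 _].
    exact: is_derive1_continuous (dp v v0).
  move=> v vb H.
  by apply: le_lt_trans (mono v vb H) _; have := p0c; have := c_gt0; lra.
have pc u : 0 <= u <= b -> c <= p u y.
  move=> /andP[u0 ub].
  suff : c / 2 - p u y <= c / 2 - p 0 y by have := p0c; lra.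
  apply: mono; first by rewrite u0.
  by move=> v /andP[v0 vu]; apply: half; rewrite v0/= (le_trans (ltW vu)).
have dV u : 0 <= u <= b -> is_derive u 1
    (fun u => (p u y)^-1 + sigma * (1 - rho) ^+ 3 / 2 * u)
    (- (sigma * (p u y * (w u y - wbar u))) / p u y ^+ 2 + sigma * (1 - rho) ^+ 3 / 2 * 1).
  move=> /andP[u0 _].
  have pu : p u y != 0 by rewrite gt_eqF.
  have H := is_derive1D (is_derive1V (f := fun u => p u y) pu (is_derive_prob dth y u0))
    (is_derive1Ml (sigma * (1 - rho) ^+ 3 / 2) (is_derive_id u (1 : R))).
  exact: is_derive1_eq H _ _.
have := is_derive1_nincr b_ge0 dV; rewrite mulr0 addr0.
have -> : sigma * (1 - rho) ^+ 3 / 2 * b = c^-1 - rho^-1 by rewrite -bE; ring.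
move=> /(_ _)/wrap[u ub|].
  have ub' : 0 <= u <= b by case/andP: ub => -> /ltW.
  have p0 := p_gt0 u y.
  have -> : - (sigma * (p u y * (w u y - wbar u))) / p u y ^+ 2 =
      - (sigma * ((w u y - wbar u) / p u y)).
    by field; rewrite gt_eqF.
  rewrite mulr1 -mulrA addrC subr_le0 ler_wpM2l ?(ltW sigma_gt0)//.
  rewrite ler_pdivlMr//.
  have := @drift_ge 1 u; rewrite mul1r => /(_ _ ltr01 (pc u ub') (pr u ub')) H.
  apply: le_trans (H _); last by case/andP: ub.
  have a0 : 0 < 1 - rho by case/andP: rho01; lra.
  have ak : 1 - rho <= 1 - p u y by have := pr u ub'; lra.
  have H2 : (1 - rho) ^+ 3 <= (1 - p u y) ^+ 2.
    apply: (@le_trans _ _ ((1 - rho) ^+ 2)).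
      rewrite exprS ler_piMl ?sqr_ge0//; by case/andP: rho01; lra.
    by rewrite lerXn2r ?nnegrE ?(ltW a0)//; lra.
  by have := ler_wpM2l (ltW p0) H2; lra.
move=> H.
have rho0 : 0 < rho by case/andP: rho01.
have : (p b y)^-1 <= rho^-1.
  have : (p 0 y)^-1 <= c^-1 by rewrite lef_pV2 ?posrE.
  by lra.
rewrite lef_pV2 ?posrE// leNgt => /negP; apply.
by apply: pr; rewrite b_ge0 lexx.
Qed.

End Fast.

End SpikeFlow.

(** * Bounds on the time of increase of the ground truth reward *)

Section SpikeReward.
Set Implicit Arguments.
Unset Strict Implicit.
Context {R : realType} {X Y : finType}.

(** [c < rho] is Markov's inequality for [rG + 1] with the strict gain [gamma]; it makes the upper
    time bound positive. *)
Lemma rho_bounds (rG : X -> Y -> R) (x : X) gamma (theta0 : 'M[R]_(#|Y|, #|X|)) y c :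
  is_reward rG -> 0 < gamma -> 0 < c -> c <= policy theta0 x y ->
  -1 < expectation (policy theta0 x) (rG x) ->
  expectation (policy theta0 x) (rG x) + gamma < rG x y ->
  [/\ 0 < rho rG x gamma theta0 y < 1 & c < rho rG x gamma theta0 y].
Proof.
move=> hrG g0 c0 cp; set V := expectation _ _ => V1 Vr.
have r0 : 0 < rG x y + 1 by lra.
rewrite /rho -/V divr_gt0 ?ltr_pdivrMr ?mul1r//; last by lra.
split; first by lra.
rewrite ltr_pdivlMr//.
have : policy theta0 x y * (rG x y + 1) <= V + 1.
  apply: mul_succ_le_expectation => [z||z]; last by have /andP[] := hrG x z.
    exact/ltW/policy_gt0.
  exact: sum_policy y.
by have := ler_wpM2r (ltW r0) cp; lra.
Qed.

Lemma t_increase_le_of_spike (S : {set X}) (rG : X -> Y -> R) (x : X) (gamma c : R)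
    (theta0 : 'M[R]_(#|Y|, #|X|)) (y : Y) (lambda : R)
    (theta : R -> 'M[R]_(#|Y|, #|X|)) :
  let rho := rho rG x gamma theta0 y in
  is_reward rG -> x \in S -> 0 < c -> c <= policy theta0 x y ->
  -1 < rG x y -> 0 < rho < 1 -> c < rho ->
  0 <= lambda <= lambda_max c rho theta0 x ->
  rlhf_flow S (fun _ => spike y) lambda theta0 theta ->
  (t_increase rG x gamma theta
     <= (2 * #|S|%:R / (1 - rho) ^+ 3 * (c^-1 - rho^-1))%:E)%E.
Proof.
move=> rho hrG xS c0 cp r1 rho01 crho /andP[l0 lmax] fl.
have [th [thE th0 dth]] := rlhf_flow_policy xS fl.
have S0 : 0 < #|S|%:R :> R by rewrite ltr0n; apply/card_gt0P; exists x.
have si0 : 0 < #|S|%:R^-1 :> R by rewrite invr_gt0.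
have a0 : 0 < 1 - rho by case/andP: rho01; lra.
have q0 := policy_gt0 theta0 x.
have m0 : 0 < min_prob theta0 x by apply/bigmin_gtP; split.
have m1 : min_prob theta0 x <= 1 by exact: bigmin_le_id.
have qM z : - ln (softmax (th 0) z) <= - ln (min_prob theta0 x).
  by rewrite lerN2 -th0 ler_ln ?posrE//; exact: bigmin_le.
set b := 2 * _ / _ * _.
have b0 : 0 <= b.
  rewrite mulr_ge0 ?divr_ge0 ?mulr_ge0 ?exprn_ge0 ?(ltW a0)//.
  by rewrite subr_ge0 lef_pV2 ?posrE ?ltW//; case/andP: rho01.
(* With [M = - ln (min_prob theta0 x)], the hypothesis reads [lambda * (32 M + 8 exp(-1)) <= c (1 -
   rho)^3], more than the [16 M + 8 exp(-1)] needed. *)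
have lamB : lambda * (2 * - ln (min_prob theta0 x) + expR (-1)) <= c * (1 - rho) ^+ 3 / 8.
  have lnm := ln_le0 m1.
  have e0 := expR_gt0 (-1 : R).
  have eE : (2 * expR 1)^-1 = expR (-1) / 2 :> R by rewrite invfM expRN mulrC.
  move: lmax; rewrite /lambda_max eE ler_pdivlMr; last by lra.
  have := mulr_ge0 l0 (ltW e0); have : lambda * ln (min_prob theta0 x) <= 0.
    by rewrite mulr_ge0_le0.
  by lra.
have bE : #|S|%:R^-1 * b * (1 - rho) ^+ 3 / 2 = c^-1 - rho^-1.
  by rewrite /b; field; rewrite !gt_eqF//; case/andP: rho01.
have cp' : c <= softmax (th 0) y by rewrite -th0.
have [t tb pt] := fast_spike_flow si0 l0 dth qM c0 cp' rho01 lamB bE b0.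
have t0 : 0 <= t by case/andP: tb.
apply: ge_ereal_inf; exists t%:E; last by rewrite lee_fin; case/andP: tb.
exists t => //=; split=> //.
have thz : policy (theta 0) x = policy theta0 x by have [-> _ _] := fl.
rewrite thz (thE t t0).
(* Markov's inequality turns [p >= rho] into the required gain, [rho] being defined for equality
   here. *)
have : rho * (rG x y + 1) <= softmax (th t) y * (rG x y + 1).
  by rewrite ler_wpM2r//; lra.
have -> : rho * (rG x y + 1) = expectation (policy theta0 x) (rG x) + gamma + 1.
  by rewrite /rho /Defs.rho divfK// gt_eqF//; lra.
have : softmax (th t) y * (rG x y + 1) <= expectation (softmax (th t)) (rG x) + 1.
  apply: mul_succ_le_expectation => [z||z]; last by have /andP[] := hrG x z.
    exact/ltW/softmax_gt0.
  exact: sum_softmax y.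
by lra.
Qed.

Lemma t_increase_ge_of_spike (S : {set X}) (rG : X -> Y -> R) (x : X) (gamma T : R)
    (theta0 : 'M[R]_(#|Y|, #|X|)) (y : Y) (lambda : R)
    (theta : R -> 'M[R]_(#|Y|, #|X|)) :
  is_reward rG -> x \in S -> 0 < gamma <= 2 -> 1 <= T ->
  policy theta0 x y <= T ^- 2 -> 0 <= lambda ->
  rlhf_flow S (fun _ => spike y) lambda theta0 theta ->
  ((#|S|%:R / Num.sqrt 2 * (1 - expR (- (gamma / 2))) * T)%:E
     <= t_increase rG x gamma theta)%E.
Proof.
move=> hrG xS /andP[g0 g2] T1 pT l0 fl.
have [th [thE th0 dth]] := rlhf_flow_policy xS fl.
have S0 : 0 < #|S|%:R :> R by rewrite ltr0n; apply/card_gt0P; exists x.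
have si0 : 0 < #|S|%:R^-1 :> R by rewrite invr_gt0.
have thz : policy (theta 0) x = softmax (th 0) by rewrite -th0; have [-> _ _] := fl.
apply: le_ereal_inf_tmp => _ [t [t0 Et] <-]; rewrite lee_fin leNgt; apply/negP => tlt.
move: Et; rewrite thz (thE t t0); apply/negP; rewrite -ltNge.
set E := expR (- (gamma / 2)) in tlt.
have E0 : 0 < E by exact: expR_gt0.
have E1 : E <= 1 by rewrite expR_le1; lra.
(* This is where [gamma <= 2] enters. *)
have E3 : 3^-1 <= E by apply: le_trans expRN1_ge _; rewrite ler_expR; lra.
have T2_1 : 1 <= T ^+ 2 by rewrite exprn_ege1.
have TT2 : T <= T ^+ 2 by rewrite expr2 ler_peMr//; lra.
have s20 : 0 < Num.sqrt 2 :> R by rewrite sqrtr_gt0.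
(* Trades the rate [377/200] for the factor [sqrt 2] of the stated bound, at the price of [4/3]. *)
have s2 : 377 / 200 <= 4 / 3 * Num.sqrt 2 :> R.
  have : (Num.sqrt 2 : R) ^+ 2 = 2 by rewrite sqr_sqrtr.
  by move: s20; nra.
have st : #|S|%:R^-1 * t * Num.sqrt 2 < (1 - E) * T.
  by rewrite mulrC mulrA mulrAC ltr_pdivrMr// mulrC -ltr_pdivlMr//; lra.
(* Taking logarithms, this says that [ln d] has dropped by less than [gamma]. The bound linear in
   [T] suffices because [T <= T^2]. *)
have dt : T ^+ 2 * E ^+ 2 < T ^+ 2 - 377 / 200 * #|S|%:R^-1 * t.
  have H1 := ler_wpM2r (mulr_ge0 (ltW si0) t0) s2.
  have E1' : 0 <= 1 - E by lra.
  have H2 := ler_wpM2l E1' TT2.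
  (* [(1 - X) ^ 2 <= 1 - 4 / 3 * X] for [0 <= X <= 2 / 3] *)
  have H3 : E ^+ 2 <= 1 - 4 / 3 * (1 - E).
    have : 0 <= (1 - E) * (E - 3^-1) by rewrite mulr_ge0//; lra.
    by lra.
  have H4 := ler_wpM2l (le_trans ler01 T2_1) H3.
  by lra.
have dt0 : 0 < T ^+ 2 - 377 / 200 * #|S|%:R^-1 * t.
  by apply: le_lt_trans dt; rewrite mulr_ge0 ?sqr_ge0.
have p0T : softmax (th 0) y * T ^+ 2 <= 1.
  by rewrite -ler_pdivlMr -?th0 ?div1r// (lt_le_trans ltr01).
have := slow_spike_flow_expectation si0 l0 dth t0 T2_1 p0T dt0 (hrG x).
have : ln (T ^+ 2 * E ^+ 2) < ln (T ^+ 2 - 377 / 200 * #|S|%:R^-1 * t).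
  by rewrite ltr_ln ?posrE// mulr_gt0 ?exprn_gt0//; lra.
rewrite lnM ?posrE ?exprn_gt0//; last by lra.
have -> : ln (E ^+ 2) = - gamma by rewrite lnXn// /E expRK mulr2n; lra.
by lra.
Qed.

End SpikeReward.

(** * Both claims from one statement, by exchanging the two outputs *)

Theorem theorem6 (R : realType) (X Y : finType) (S : {set X})
    (rG : X -> Y -> R) (hrG : is_reward rG) (x : X) (hx : x \in S)
    (V0 : R) (hV0 : -1 < V0 < 1) (gamma : R) (hgamma : 0 < gamma)
    (y y' : Y) (hy : V0 + gamma < rG x y) (hy' : V0 + gamma < rG x y')
    (T : R) (hT : 1 <= T) (c : R) (hc : 0 < c < 1) :
  let Pi := policy_family rG x V0 T c y' y in
  let Pi' := policy_family rG x V0 T c y y' in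
  exists rRM rRM' : X -> Y -> R,
    [/\ is_reward rRM, is_reward rRM',
      (forall theta0 : 'M[R]_(#|Y|, #|X|), Pi (policy theta0) ->
        let rho := rho rG x gamma theta0 y in
        [/\ 0 < rho < 1,
          (forall (lambda : R) (theta : R -> 'M[R]_(#|Y|, #|X|)),
            0 <= lambda <= lambda_max c rho theta0 x ->
            rlhf_flow S rRM lambda theta0 theta ->
            (t_increase rG x gamma theta
              <= (2 * #|S|%:R / (1 - rho) ^+ 3 * (c^-1 - rho^-1))%:E)%E) &
          (forall (lambda : R) (theta : R -> 'M[R]_(#|Y|, #|X|)),
            0 <= lambda ->
            rlhf_flow S rRM' lambda theta0 theta ->
            ((#|S|%:R / Num.sqrt 2 * (1 - expR (- (gamma / 2))) * T)%:E
              <= t_increase rG x gamma theta)%E)]) &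
      (forall theta0 : 'M[R]_(#|Y|, #|X|), Pi' (policy theta0) ->
        let rho' := rho rG x gamma theta0 y' in
        [/\ 0 < rho' < 1,
          (forall (lambda : R) (theta : R -> 'M[R]_(#|Y|, #|X|)),
            0 <= lambda <= lambda_max c rho' theta0 x ->
            rlhf_flow S rRM' lambda theta0 theta ->
            (t_increase rG x gamma theta
              <= (2 * #|S|%:R / (1 - rho') ^+ 3 * (c^-1 - rho'^-1))%:E)%E) &
          (forall (lambda : R) (theta : R -> 'M[R]_(#|Y|, #|X|)),
            0 <= lambda ->
            rlhf_flow S rRM lambda theta0 theta ->
            ((#|S|%:R / Num.sqrt 2 * (1 - expR (- (gamma / 2))) * T)%:E
              <= t_increase rG x gamma theta)%E)])].
Proof.
move=> Pi Pi'; exists (fun _ => spike y), (fun _ => spike y').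
have reward_spike z : @is_reward R X Y (fun _ => spike z).
  by move=> ? k; rewrite /spike; case: ifP => _; lra.
(* [V0 > -1] and [rG <= 1] force [gamma < 2]. *)
have g2 : gamma <= 2 by have /andP[] := hrG x y; lra.
have bounds ylow yhigh : V0 + gamma < rG x yhigh ->
    forall theta0, policy_family rG x V0 T c ylow yhigh (policy theta0) ->
    let rho := rho rG x gamma theta0 yhigh in
    [/\ 0 < rho < 1,
      (forall (lambda : R) (theta : R -> 'M[R]_(#|Y|, #|X|)),
        0 <= lambda <= lambda_max c rho theta0 x ->
        rlhf_flow S (fun _ => spike yhigh) lambda theta0 theta ->
        (t_increase rG x gamma theta
          <= (2 * #|S|%:R / (1 - rho) ^+ 3 * (c^-1 - rho^-1))%:E)%E) &
      (forall (lambda : R) (theta : R -> 'M[R]_(#|Y|, #|X|)),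
        0 <= lambda ->
        rlhf_flow S (fun _ => spike ylow) lambda theta0 theta ->
        ((#|S|%:R / Num.sqrt 2 * (1 - expR (- (gamma / 2))) * T)%:E
          <= t_increase rG x gamma theta)%E)].
  move=> Vr theta0 [theta1 [EV plow phigh] pE] rho.
  (* Membership in the family provides parameters [theta1] with the same policy, possibly different
     from [theta0]. *)
  have pEx : policy theta1 x = policy theta0 x by rewrite pE.
  rewrite pEx in EV plow phigh.
  have [V1 _] := andP hV0; have [c0 _] := andP hc.
  rewrite -EV in V1 Vr.
  have [rho01 crho] := rho_bounds hrG hgamma c0 phigh V1 Vr.
  split=> // lambda theta.
    by apply: t_increase_le_of_spike => //; lra.
  by apply: t_increase_ge_of_spike => //; rewrite hgamma.
by split=> //; exact: bounds.
Qed.
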